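(* For every finite poset $P$, $$Av_P(132) \leq Av_P(123).$$ Moreover, the inequality is strict, i.e. $Av_P(132) < Av_P(123)$, if and only if $P$ contains at least one of the five-element posets $Q_1$, $Q_2$, $Q_3$ as an induced subposet (up to isomorphism), where each $Q_i$ has underlying set $\{a,b,c,d,e\}$ and the following strict order relations (all pairs not listed being incomparable): - $Q_1$: $d<a$, $a<c$, $d<c$, $e<b$, $b<c$, $e<c$; - $Q_2$: $d<a$, $e<a$, $e<b$, $a<c$, $b<c$, $d<c$, $e<c$; - $Q_3$: $e<d$, $d<a$, $a<c$, $e<a$, $e<c$, $d<c$, $e<b$, $b<c$.
   Context: Let $P$ be a poset with $n$ elements. A permutation on $P$ is a bijection $\sigma\colon\{1,\ldots,n\}\to P$; write $\sigma_i=\sigma(i)$. The permutation $\sigma$ contains the pattern $123$ if there exist indices $i_1<i_2<i_3$ with $\sigma_{i_1}<\sigma_{i_2}<\sigma_{i_3}$ in $P$; it contains the pattern $132$ if there exist indices $i_1<i_2<i_3$ with $\sigma_{i_1}<\sigma_{i_3}<\sigma_{i_2}$ in $P$. Otherwise $\sigma$ avoids the pattern. $Av_P(\pi)$ denotes the number of permutations on $P$ that avoid the pattern $\pi$. An induced subposet of $P$ is a subset of $P$ with the order relation restricted from $P$ (so both comparabilities and incomparabilities are inherited). *)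

(* Defs.v *)
From mathcomp Require Import all_boot all_order.

Set Implicit Arguments.
Unset Strict Implicit.
Unset Printing Implicit Defensive.

Local Open Scope order_scope.

Section Patterns.
Variables (disp : Order.disp_t) (P : finPOrderType disp).
Implicit Type s : {ffun 'I_#|P| -> P}.

(* Positions are numbered 0, ..., n - 1 instead of 1, ..., n. *)
Definition is_permutation_on s : bool :=
  injectiveb s && [forall x : P, exists i, s i == x].

Definition contains123 s : bool :=
  [exists i1 : 'I_#|P|, exists i2 : 'I_#|P|, exists i3 : 'I_#|P|,
    [&& (i1 < i2)%N, (i2 < i3)%N, s i1 < s i2 & s i2 < s i3]].

Definition contains132 s : bool :=
  [exists i1 : 'I_#|P|, exists i2 : 'I_#|P|, exists i3 : 'I_#|P|,
    [&& (i1 < i2)%N, (i2 < i3)%N, s i1 < s i3 & s i3 < s i2]].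

Definition Av123 : nat :=
  #|[set s | is_permutation_on s & ~~ contains123 s]|.

Definition Av132 : nat :=
  #|[set s | is_permutation_on s & ~~ contains132 s]|.

End Patterns.

Arguments Av123 {disp} P.
Arguments Av132 {disp} P.

Inductive abcde : Type := qa | qb | qc | qd | qe.

(* Each relation below is the strict order: Q x y stands for x < y. *)
Definition Q1 : rel abcde := fun x y =>
  match x, y with
  | qd, qa | qa, qc | qd, qc | qe, qb | qb, qc | qe, qc => true
  | _, _ => false
  end.

Definition Q2 : rel abcde := fun x y =>
  match x, y with
  | qd, qa | qe, qa | qe, qb | qa, qc | qb, qc | qd, qc | qe, qc => true
  | _, _ => false
  end.

Definition Q3 : rel abcde := fun x y =>
  match x, y with
  | qe, qd | qd, qa | qa, qc | qe, qa | qe, qc | qd, qc | qe, qb | qb, qc =>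
    true
  | _, _ => false
  end.

Lemma Q1_strict_order : irreflexive Q1 /\ transitive Q1.
Proof. by split=> [[]|[] [] []]. Qed.

Lemma Q2_strict_order : irreflexive Q2 /\ transitive Q2.
Proof. by split=> [[]|[] [] []]. Qed.

Lemma Q3_strict_order : irreflexive Q3 /\ transitive Q3.
Proof. by split=> [[]|[] [] []]. Qed.

(* The range of f is the induced subposet of P isomorphic to (abcde, Q). *)
Definition contains_induced (disp : Order.disp_t) (P : finPOrderType disp)
    (Q : rel abcde) : Prop :=
  exists f : abcde -> P, injective f /\ forall x y, (f x < f y) = Q x y.

(* Main.v *)
Require Import Defs.
From mathcomp Require Import all_boot all_order.

(** Build a permutation of P from left to right.  Call an entry minimal-so-far
    if no earlier entry lies below it.  At each moment let Z be the set of the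
    elements that are unplaced and have no placed element below them; the other
    unplaced elements, those above some placed entry, are the available ones.
    The next entry is either an element m of Z, which is then minimal-so-far
    and makes the elements of Z above m available, or an available element x.
    An available x followed by an available z makes a pattern 132 when z < x
    and a pattern 123 when x < z, and every occurrence of the patterns arises in
    this way.  So a permutation avoids 132 (avoids 123) iff each entry taken from
    the available elements is minimal (maximal) among them.

    To compare the two processes, keep the available elements in a word W that
    is a linear extension.  Minimal elements are taken by removing the head of
    W.  Maximal ones are taken by Schuetzenberger promotion: slide the head
    upwards through W until it drops out.  Promotion is invertible, hence in
    both processes the word at each moment can be recovered from the rest of the
    permutation, and permutations are in bijection with codes, that is lists of
    instructions <<place m and insert the new available elements into W at given
    places>> and <<take an element out of W>> ([codes_of_avoiders]).  The two
    kinds of codes differ only in the requirement that the words be linear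
    extensions at each insertion.

    Run the same code in both ways.  The promotion word V stays pointwise below
    the head-removal word W, since each slide moves smaller elements to later
    places.  A new element d is never above an old one, so an insertion is
    wrong only if d is put behind an old element above it; a pointwise smaller
    word has fewer such obstacles.  Thus every code that is valid for head
    removal is valid for promotion ([valid_head_promotion]), which is the
    inequality.

    The converse can fail only when some d is inserted behind v in V and behind
    w in W, with v <= w, d < w and not d < v.  With m a placed entry below v and
    m' the entry that makes d available, one gets m < v < w, m' < d < w, not
    m <= d and not d <= v ([obstruction]).  Sorting by the position of m' with
    respect to m and v, these are the three posets Q3, Q2 and Q1
    ([obstructionE]).  Conversely an obstruction m < a < c, m' < b < c yields a
    code that is valid only for promotion: place m, take out all but one of the
    elements above m in such a way that promotion keeps an element a0 <= a while
    head removal keeps an element above b, then place m' and insert b behind the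
    remaining element ([obstruction_strict]). *)

Set Implicit Arguments.
Unset Strict Implicit.
Unset Printing Implicit Defensive.

Import Order.TTheory.
Local Open Scope order_scope.

(** * Linear extensions and ways to take an element out of them *)

Section Words.
Context {disp : Order.disp_t} {P : finPOrderType disp}.
Implicit Types (x y z h u : P) (s V W R : seq P) (p : seq (option P)).

Definition linext s := pairwise (fun x y => ~~ (y < x)) s.

(** A way of taking elements out of a linear extension.  [out h V] leaves the
    word [h :: V] and [rest h V] remains; [forbids y z] says that y may not be
    taken while z is present.  The operation is required to be a bijection from
    nonempty linear extensions onto pairs of an allowed element and a linear
    extension of the others, with inverse [undo]: this is all that the coding of
    permutations uses, so that it is done once for both patterns. *)
Record removal := Removal {
  forbids : rel P;
  out : P -> seq P -> P;
  rest : P -> seq P -> seq P;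
  undo : P -> seq P -> P * seq P;
  forbids_comparable : forall x z, forbids x z -> (x < z) || (z < x);
  removeP : forall h V, linext (h :: V) ->
    [/\ all (fun z => ~~ forbids (out h V) z) (rest h V),
        linext (rest h V), perm_eq (out h V :: rest h V) (h :: V)
      & undo (out h V) (rest h V) = (h, V)];
  undoP : forall y R, linext R -> all (fun z => ~~ forbids y z) R ->
    let: (h, V) := undo y R in
    [/\ linext (h :: V), perm_eq (h :: V) (y :: R),
        out h V = y & rest h V = R]
}.

Lemma head_removeP h V : linext (h :: V) ->
  [/\ all (fun z => ~~ (z < h)) V, linext V, perm_eq (h :: V) (h :: V)
    & (h, V) = (h, V)].
Proof. by rewrite /linext pairwise_cons => /andP[]. Qed.

Lemma head_undoP y R : linext R -> all (fun z => ~~ (z < y)) R ->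
  [/\ linext (y :: R), perm_eq (y :: R) (y :: R), y = y & R = R].
Proof. by move=> lR yR; split=> //; rewrite /linext pairwise_cons yR. Qed.

Lemma gt_comparable x z : z < x -> (x < z) || (z < x).
Proof. by move->; rewrite orbT. Qed.

Lemma lt_comparable x z : x < z -> (x < z) || (z < x).
Proof. by move->. Qed.

Definition remove_head : removal :=
  @Removal (fun y z => z < y) (fun h _ => h) (fun _ V => V) pair
    gt_comparable head_removeP head_undoP.

(** Promotion: the first entry above the held element h takes over as the held
    one, h moves to its place, and so on; the element held at the end leaves. *)
Fixpoint promote_out h V :=
  if V is u :: V' then promote_out (if h < u then u else h) V' else h.

Fixpoint promote_rest h V :=
  if V is u :: V' then
    (if h < u then h else u) :: promote_rest (if h < u then u else h) V'
  else [::].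

(** Inverse promotion, from right to left: y slides downwards to the front. *)
Fixpoint demote y R :=
  if R is u :: R' then
    let: (h, V) := demote y R' in if u < h then (u, h :: V) else (h, u :: V)
  else (y, [::]).

Lemma perm_promote h V : perm_eq (promote_out h V :: promote_rest h V) (h :: V).
Proof.
apply/permP => a; elim: V h => [//|u V IH] h /=.
by case: ifP => _; rewrite addnCA; have /= -> := IH _; rewrite 1?addnCA.
Qed.

Lemma promoteP h V : linext (h :: V) ->
  [/\ all (fun z => ~~ (promote_out h V < z)) (promote_rest h V),
      linext (promote_rest h V),
      perm_eq (promote_out h V :: promote_rest h V) (h :: V)
    & demote (promote_out h V) (promote_rest h V) = (h, V)].
Proof.
move=> lhV; suff [? ? ?]: [/\ all (fun z => ~~ (promote_out h V < z)) (promote_rest h V),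
  linext (promote_rest h V) & demote (promote_out h V) (promote_rest h V) = (h, V)].
  by split=> //; apply: perm_promote.
elim: V h lhV => [//|u V IH] h; rewrite /linext /= -!/(linext _).
case/and3P=> /andP[uh hV] uV lV.
have perm_all_promote (a : pred P) k : a k -> all a V ->
    a (promote_out k V) && all a (promote_rest k V).
  by move=> ak aV; have := perm_all a (perm_promote k V); rewrite /= ak aV.
case: ifP => hu.
  have [mx lr dm] := IH u (introT andP (conj uV lV)).
  have /andP[oh rh] := @perm_all_promote (fun z => ~~ (z < h)) u uh hV.
  by rewrite oh rh /= -/(linext _) lr dm hu; split.
have [mx lr dm] := IH h (introT andP (conj hV lV)).
have /andP[ou ru] := @perm_all_promote (fun z => ~~ (z < u)) h (negbT hu) uV.
by rewrite ou ru /= -/(linext _) lr dm (negbTE uh); split.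
Qed.

Lemma perm_demote y R :
  perm_eq ((demote y R).1 :: (demote y R).2) (y :: R).
Proof.
apply/permP => a; elim: R => [//|u R] /=.
case: (demote y R) => h V /=; case: ifP => _ /= IH.
  by rewrite IH addnCA.
by rewrite addnCA IH addnCA.
Qed.

Lemma demoteP y R : linext R -> all (fun z => ~~ (y < z)) R ->
  let: (h, V) := demote y R in
  [/\ linext (h :: V), perm_eq (h :: V) (y :: R),
      promote_out h V = y & promote_rest h V = R].
Proof.
elim: R => [//|u R IH] /andP[uR lR] /= /andP[yu yR].
have := perm_demote y (u :: R); move: (perm_demote y R) => /=.
case: (demote y R) (IH lR yR) => h V [] /= /andP[hV lV] _ oV rV pV.
have memV := perm_mem pV.
(* the element h that reached u is y or comes from behind u in R *)
have hu : ~~ (h < u).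
  by have := memV h; rewrite !inE eqxx /= => /esym/orP[/eqP->//|/(allP uR)].
case: ifP => uh pp; split=> //=; rewrite ?uh ?(negbTE hu) ?oV ?rV //.
  rewrite hV /= -/(linext _) lV !andbT.
  apply/allP => z zV; have := memV z; rewrite !inE zV orbT => /esym/orP[/eqP->//|].
  exact: (allP uR).
rewrite hV /= -/(linext _) lV andbT.
apply/allP => z zV; have := memV z; rewrite !inE zV orbT => /esym/orP[/eqP->//|].
exact: (allP uR).
Qed.

Definition remove_promotion : removal :=
  @Removal (fun y z => y < z) promote_out promote_rest demote
    lt_comparable promoteP demoteP.

(** * Codes *)

(** A pattern describes an insertion into a word: [Some d] is a new element and
    each [None] stands for the next old one.  Patterns that are too long for
    the old word are ruled out by [insertable]. *)
Fixpoint fill p W :=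
  match p, W with
  | Some d :: p', _ => d :: fill p' W
  | None :: p', w :: W' => w :: fill p' W'
  | None :: p', [::] => fill p' [::]
  | [::], _ => [::]
  end.

Lemma perm_fill p W : count_mem None p = size W ->
  perm_eq (fill p W) (pmap id p ++ W).
Proof.
elim: p W => [[] //|[d|] p IH] W /=.
  by rewrite add0n perm_cons; apply: IH.
case: W => [|w W] //= [/IH pW].
by rewrite -[w :: W]cat1s perm_sym perm_catCA perm_sym /= perm_cons.
Qed.

Definition blanks (Z : {set P}) W := [seq if y \in Z then Some y else None | y <- W].

Lemma fill_blanks (Z : {set P}) W : fill (blanks Z W) [seq y <- W | y \notin Z] = W.
Proof. by elim: W => //= y W IH; case: ifP => /= _; rewrite IH. Qed.

Lemma pmap_blanks (Z : {set P}) W : pmap id (blanks Z W) = [seq y <- W | y \in Z].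
Proof. by elim: W => //= y W <-; case: ifP. Qed.

Lemma count_blanks (Z : {set P}) W :
  count_mem None (blanks Z W) = size [seq y <- W | y \notin Z].
Proof. by elim: W => //= y W ->; case: ifP. Qed.

Lemma blanks_fill (Z : {set P}) p W :
    count_mem None p = size W -> {subset pmap id p <= Z} ->
    all (fun w => w \notin Z) W ->
  blanks Z (fill p W) = p /\ [seq y <- fill p W | y \notin Z] = W.
Proof.
elim: p W => [[] //|[d|] p IH] W /=.
  rewrite add0n => cW sZ WZ; have dZ : d \in Z by apply: sZ; rewrite inE eqxx.
  have [|-> ->] := IH W cW _ WZ; last by rewrite dZ.
  by move=> y yp; apply: sZ; rewrite inE yp orbT.
case: W => [|w W] //= [cW] sZ /andP[wZ WZ].
by have [-> ->] := IH W cW sZ WZ; rewrite wZ (negbTE wZ).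
Qed.

(** [Some (m, p)] places m and inserts the elements that it makes available by
    the pattern p; [None] takes an element out of the word. *)
Definition instruction := option (P * seq (option P)).
Implicit Types (Z : {set P}) (c : seq instruction) (E : removal).

Definition above Z m := [set z in Z | m < z].
Definition step Z m := [set z in Z | ~~ (m <= z)].

Definition insertable Z m W p :=
  perm_eq (pmap id p) (enum (above Z m)) && (count_mem None p == size W).

Lemma perm_enum_step Z m : m \in Z ->
  perm_eq (enum Z) (m :: enum (above Z m) ++ enum (step Z m)).
Proof.
move=> mZ; apply: uniq_perm; first exact: enum_uniq.
  rewrite cons_uniq cat_uniq !enum_uniq mem_cat !mem_enum !inE ltxx lexx !andbF /=.
  rewrite andbT; apply/hasPn => z; rewrite !mem_enum !inE => /andP[_].
  by apply: contra => /andP[_ /ltW].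
move=> z; rewrite inE mem_cat !mem_enum !inE; case: eqVneq => [->|zm] //=.
by rewrite -andb_orr lt_neqAle [m == z]eq_sym zm orbN andbT.
Qed.

(** The last condition expresses that what is available is closed upwards: an
    element above an available one is above the same placed entry. *)
Definition state_ok Z W :=
  [/\ linext W, uniq W & forall w z, w \in W -> z \in Z -> ~~ (w <= z)].

Lemma state_pop E Z h V : state_ok Z (h :: V) -> state_ok Z (rest E h V).
Proof.
case=> lV uV hZ; have [_ lr pr _] := removeP E lV; split=> //.
  by move: uV; rewrite -(perm_uniq pr) => /andP[].
by move=> w z wr; apply: hZ; rewrite -(perm_mem pr) inE wr orbT.
Qed.

Lemma state_push Z m W p : state_ok Z W -> m \in Z ->
  insertable Z m W p -> linext (fill p W) -> state_ok (step Z m) (fill p W).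
Proof.
case=> lW uW hZ mZ /andP[pp /eqP cp] lf; have pf := perm_fill cp.
have memf w : (w \in fill p W) = (w \in above Z m) || (w \in W).
  by rewrite (perm_mem pf) mem_cat (perm_mem pp) mem_enum.
split=> //.
  rewrite (perm_uniq pf) cat_uniq (perm_uniq pp) enum_uniq uW andbT /=.
  apply/hasPn => w wW; rewrite (perm_mem pp) mem_enum inE; apply/negP => /andP[wZ _].
  by have := hZ w w wW wZ; rewrite lexx.
move=> w z; rewrite memf !inE => /orP[/andP[_ mw] /andP[_]|wW /andP[zZ _]].
  by apply: contra; apply: le_trans; apply: ltW.
exact: hZ.
Qed.

Fixpoint valid E Z W c :=
  match c with
  | [::] => (W == [::]) && (Z == set0)
  | None :: c' => if W is h :: V then valid E Z (rest E h V) c' else false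
  | Some (m, p) :: c' =>
      [&& m \in Z, insertable Z m W p, linext (fill p W)
        & valid E (step Z m) (fill p W) c']
  end.

Fixpoint decode E Z W c :=
  match c with
  | [::] => [::]
  | None :: c' =>
      if W is h :: V then out E h V :: decode E Z (rest E h V) c' else [::]
  | Some (m, p) :: c' => m :: decode E (step Z m) (fill p W) c'
  end.

(** [word] recovers the word of available elements from the part s of the
    permutation that is still to come, by undoing the steps from the end. *)
Fixpoint word E Z s :=
  if s is x :: s' then
    if x \in Z then [seq y <- word E (step Z x) s' | y \notin Z]
    else let: (h, V) := undo E x (word E Z s') in h :: V
  else [::].

Fixpoint encode E Z s :=
  if s is x :: s' then
    if x \in Z then
      Some (x, blanks Z (word E (step Z x) s')) :: encode E (step Z x) s'
    else None :: encode E Z s'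
  else [::].

(** The condition on a final part s of a permutation, when Z is the set of
    unplaced elements that are not yet available. *)
Fixpoint avoids E Z s :=
  if s is x :: s' then
    if x \in Z then avoids E (step Z x) s'
    else all (fun z => (z \in Z) || ~~ forbids E x z) s' && avoids E Z s'
  else true.

Lemma decodeP E Z W c : state_ok Z W -> valid E Z W c ->
  let s := decode E Z W c in
  [/\ perm_eq s (W ++ enum Z), avoids E Z s, word E Z s = W & encode E Z s = c].
Proof.
elim: c Z W => [|[[m p]|] c IH] Z W okZ /=.
- by case/andP=> /eqP-> /eqP->; rewrite enum_set0.
- case/and4P=> mZ ins lf vc.
  have [ps av wd en] := IH _ _ (state_push okZ mZ ins lf) vc.
  case: okZ => lW uW hZ; case/andP: ins => pp /eqP cp.
  have WZ : all (fun w => w \notin Z) W.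
    by apply/allP=> w wW; apply/negP => /(hZ w w wW); rewrite lexx.
  have pZ : {subset pmap id p <= Z}.
    by move=> d; rewrite (perm_mem pp) mem_enum inE => /andP[].
  have [bp fW] := blanks_fill cp pZ WZ.
  rewrite mZ wd bp fW en; split=> //.
  apply: (@perm_trans _ (m :: W ++ enum (above Z m) ++ enum (step Z m))); last first.
    by rewrite -(cat1s m (W ++ _)) perm_catCA perm_cat2l perm_sym perm_enum_step.
  rewrite perm_cons (perm_trans ps) // catA perm_cat2r.
  by rewrite (perm_trans (perm_fill cp)) // perm_catC perm_cat2l.
- case: W okZ => // h V okZ vc.
  have [ps av wd en] := IH _ _ (state_pop E okZ) vc.
  case: okZ => lW uW hZ; have [nf lr pr un] := removeP E lW.
  have xZ : out E h V \notin Z.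
    apply/negP => xZ; have := hZ (out E h V) _ _ xZ.
    by rewrite -(perm_mem pr) inE eqxx lexx => /(_ isT).
  rewrite /= (negbTE xZ) wd un en; split=> //.
    apply: (@perm_trans _ ((out E h V :: rest E h V) ++ enum Z)).
      by rewrite /= perm_cons.
    by rewrite -cat_cons perm_cat2r.
  rewrite av andbT; apply/allP => z; rewrite (perm_mem ps) mem_cat mem_enum.
  by case/orP=> [/(allP nf)->|->//]; rewrite orbT.
Qed.

Definition suffix_ok Z s :=
  [/\ uniq s, {subset Z <= s}
    & forall y z, y \in s -> y \notin Z -> z \in Z -> ~~ (y <= z)].

Lemma encodeP E Z s : suffix_ok Z s -> avoids E Z s ->
  let W := word E Z s in
  [/\ perm_eq W [seq y <- s | y \notin Z], linext W,
      valid E Z W (encode E Z s) & decode E Z W (encode E Z s) = s].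
Proof.
elim: s Z => [|x s IH] Z [].
  by move=> _ Zs _ _; split=> //=; apply/eqP/setP => z; rewrite inE; apply/negP => /Zs.
case/andP=> xs us Zs yZ /=; case: ifPn => xZ.
  move=> av; have oks : suffix_ok (step Z x) s.
    split=> // [z|y z ys]; rewrite ?inE => zZ.
      case/andP: zZ => zZ; have := Zs z zZ; rewrite inE.
      by case: eqVneq => // ->; rewrite lexx.
    case/andP=> zZ' xz; case yZ' : (y \in Z).
      move: zZ; rewrite yZ' /= negbK => xy.
      by apply: contra xz; apply: le_trans.
    by apply: yZ => //; rewrite ?inE ?ys ?orbT ?yZ'.
  have [pw lw vw dw] := IH _ oks av; set W := word E _ s in pw lw vw dw *.
  rewrite /= fill_blanks xZ lw vw dw; split=> //.
  - rewrite /= (perm_trans (perm_filter _ pw)) // -filter_predI.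
    suff /eq_filter-> : predI (fun y => y \notin Z) (fun y => y \notin step Z x)
        =1 (fun y => y \notin Z) by [].
    by move=> z; rewrite /= !inE; case: (z \in Z).
  - by apply: subseq_pairwise lw; apply: filter_subseq.
  rewrite /= andbT /insertable count_blanks eqxx andbT pmap_blanks.
  apply: uniq_perm; rewrite ?enum_uniq //.
    by rewrite filter_uniq // (perm_uniq pw) filter_uniq.
  move=> z; rewrite mem_enum mem_filter (perm_mem pw) mem_filter !inE.
  case zZ: (z \in Z) => //=; rewrite negbK lt_neqAle.
  have := Zs z zZ; rewrite inE eq_sym; case: eqVneq => [<-|_ /= ->] /=.
    by rewrite (negbTE xs) andbF.
  by rewrite andbT.
case/andP=> nf av; have oks : suffix_ok Z s.
  split=> // [z zZ|y z ys].
    by have := Zs z zZ; rewrite inE; case: eqVneq zZ xZ => // -> ->.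
  by apply: yZ; rewrite inE ys orbT.
have [pw lw vw dw] := IH _ oks av; set W := word E _ s in pw lw vw dw *.
have := @undoP E x W lw; case: (undo E x W) => h V [].
  apply/allP => z; rewrite (perm_mem pw) mem_filter => /andP[zZ zs].
  by have := allP nf z zs; rewrite (negbTE zZ).
move=> lV pV; rewrite /= => -> ->; rewrite vw dw; split=> //.
by rewrite (perm_trans pV) //= perm_cons.
Qed.

(** * Running one code in two ways *)

Lemma mem_fill p W y : y \in fill p W -> (y \in pmap id p) || (y \in W).
Proof.
elim: p W => [|[d|] p IH] W //=.
  by rewrite !inE; case: eqVneq => //= _ /IH.
case: W => [|w W]; first exact: IH.
by rewrite !inE; case: eqVneq => //= _; [rewrite orbT | move/IH].
Qed.

Definition pointwise_le V W := all2 (fun v w => v <= w) V W.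

Lemma pointwise_le_fill p V W :
  pointwise_le V W -> pointwise_le (fill p V) (fill p W).
Proof.
rewrite /pointwise_le; elim: p V W => [|[d|] p IH] [|v V] [|w W] //= vw.
- by rewrite lexx IH.
- by rewrite lexx IH //=.
- exact: (IH [::] [::]).
- by case/andP: vw => -> /IH.
Qed.

Lemma promote_le v V : pointwise_le (promote_rest v V) V.
Proof.
rewrite /pointwise_le; elim: V v => //= u V IH v.
by case: ifP => [/ltW->|_]; rewrite ?lexx IH.
Qed.

Lemma pointwise_le_trans : transitive pointwise_le.
Proof.
rewrite /pointwise_le => W; elim: W => [|w W IH] [|v V] [|x X] //=.
by case/andP=> vw VW /andP[wx WX]; rewrite (le_trans vw wx) IH.
Qed.

Lemma mem_pmap_fill p W d : d \in pmap id p -> d \in fill p W.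
Proof.
elim: p W => [|[e|] p IH] W //=; first by rewrite !inE; case: eqVneq => //= _ /IH.
by case: W => [|w W] /IH // dW; rewrite inE dW orbT.
Qed.

(** New elements are never above old ones, so only a new element placed behind
    an old one above it can spoil an insertion, and lowering the old entries
    removes such cases. *)
Lemma linext_fill_le p V W : pointwise_le V W -> linext V ->
    (forall d v, d \in pmap id p -> v \in V -> ~~ (v <= d)) ->
  linext (fill p W) -> linext (fill p V).
Proof.
rewrite /linext /pointwise_le.
elim: p V W => [|[d|] p IH] V W VW lV ndV //=.
  case/andP=> dW lW; apply/andP; split.
    apply/allP => y /mem_fill/orP[yp|yV].
      by apply: (allP dW); apply: mem_pmap_fill.
    by apply/negP => /ltW; apply/negP/ndV; rewrite ?inE ?eqxx.
  by apply: IH lW => // d' v d'p; apply: ndV; rewrite inE d'p orbT.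
case: V W VW lV ndV => [|v V] [|w W] //=.
case/andP=> vw VW /andP[vV lV] ndV /andP[wW lW]; apply/andP; split.
  apply/allP => y /mem_fill/orP[yp|]; last exact: (allP vV).
  have := allP wW y (mem_pmap_fill _ yp); apply: contra.
  by move/lt_le_trans; apply.
by apply: IH lW => // d x dp xV; apply: ndV; rewrite ?inE ?xV ?orbT.
Qed.

Lemma valid_head_promotion Z V W c : state_ok Z V -> pointwise_le V W ->
  valid remove_head Z W c -> valid remove_promotion Z V c.
Proof.
elim: c Z V W => [|[[m p]|] c IH] Z V W okV VW /=.
- by case/andP=> /eqP W0; move: VW; rewrite W0; case: (V).
- case/and4P=> mZ ins lf vc; case/andP: (ins) => pp cp.
  have sVW : size V = size W by move: VW; rewrite /pointwise_le all2E => /andP[/eqP].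
  have insV : insertable Z m V p by rewrite /insertable pp sVW.
  have lfV : linext (fill p V).
    case: okV => lV uV hV; apply: linext_fill_le VW lV _ lf => d v.
    by rewrite (perm_mem pp) mem_enum inE => /andP[dZ _] /hV; apply.
  rewrite mZ insV lfV; apply: IH vc; last exact: pointwise_le_fill.
  exact: state_push insV lfV.
- case: V W okV VW => [|v V] [|w W] // okV /andP[_ VW]; apply: IH.
    exact: (state_pop remove_promotion okV).
  exact: pointwise_le_trans (promote_le v V) VW.
Qed.

(** In the names of the five-element posets, m and m' are d and e. *)
Definition obstruction := exists m a m' b c : P,
  [/\ m < a < c, m' < b < c, ~~ (m <= b) & ~~ (b <= a)].

(** Each available element lies above a placed entry m, and no element of Z
    does. *)
Definition released Z V :=
  forall v, v \in V -> exists2 m, m < v & forall z, z \in Z -> ~~ (m <= z).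

(** Raising the old entries is harmless when it never lifts one above a new
    element d while the original entry is not above d. *)
Lemma linext_fill_ge p V W : pointwise_le V W -> linext W ->
    (forall d w, d \in pmap id p -> w \in W -> ~~ (w <= d)) ->
    (forall v d w, v \in V -> d \in pmap id p -> v <= w -> d < w -> d < v) ->
  linext (fill p V) -> linext (fill p W).
Proof.
rewrite /linext /pointwise_le.
elim: p V W => [|[d|] p IH] V W VW lW ndW no //=.
  case/andP=> dV lV; apply/andP; split.
    apply/allP => y /mem_fill/orP[yp|yV].
      by apply: (allP dV); apply: mem_pmap_fill.
    by apply/negP => /ltW; apply/negP/ndW; rewrite ?inE ?eqxx.
  apply: IH VW lW _ _ lV => [d' v d'p|v d' w vV d'p].
    by apply: ndW; rewrite inE d'p orbT.
  by apply: no => //; rewrite inE d'p orbT.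
case: V W VW lW ndW no => [|v V] [|w W] //=.
case/andP=> vw VW /andP[wW lW] ndW no /andP[vV lV]; apply/andP; split.
  apply/allP => y /mem_fill/orP[yp|]; last exact: (allP wW).
  have := allP vV y (mem_pmap_fill _ yp); apply: contra => yw.
  by apply: no yw; rewrite ?inE ?eqxx.
apply: IH VW lW _ _ lV => [d x dp xW|x d y xV dp yW].
  by apply: ndW; rewrite ?inE ?xW ?orbT.
by apply: no; rewrite ?inE ?xV ?yW ?orbT.
Qed.

Lemma released_pop E Z h V : linext (h :: V) ->
  released Z (h :: V) -> released Z (rest E h V).
Proof.
move=> /(removeP E)[_ _ pV _] rV v vV; apply: rV.
by rewrite -(perm_mem pV) inE vV orbT.
Qed.

Lemma released_push Z m p V : released Z V -> insertable Z m V p ->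
  released (step Z m) (fill p V).
Proof.
move=> rV /andP[pp _] v /mem_fill; rewrite (perm_mem pp) mem_enum inE.
case/orP=> [/andP[_ mv]|/rV[n nv nZ]]; last first.
  by exists n => // z; rewrite inE => /andP[/nZ].
by exists m => // z; rewrite inE => /andP[].
Qed.

(** A violation at the insertion of d behind w yields an obstruction: the entry
    v of the promotion word in the place of w, the placed entry n below v, and
    the entry m that makes d available. *)
Lemma valid_promotion_head Z V W c : ~ obstruction ->
    state_ok Z V -> state_ok Z W -> pointwise_le V W -> released Z V ->
  valid remove_promotion Z V c -> valid remove_head Z W c.
Proof.
move=> no; elim: c Z V W => [|[[m p]|] c IH] Z V W okV okW VW rV /=.
- by case/andP=> /eqP V0; move: VW; rewrite V0; case: (W).
- case/and4P=> mZ ins lf vc; case/andP: (ins) => pp cp.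
  have sVW : size V = size W by move: VW; rewrite /pointwise_le all2E => /andP[/eqP].
  have insW : insertable Z m W p by rewrite /insertable pp -sVW.
  have lfW : linext (fill p W).
    case: okW => lW _ hW; apply: linext_fill_ge VW lW _ _ lf => [d w|v d w vV].
      by rewrite (perm_mem pp) mem_enum inE => /andP[dZ _] /hW; apply.
    rewrite (perm_mem pp) mem_enum inE => /andP[dZ md] vw dw.
    have [n nv nZ] := rV v vV; have nd := nZ d dZ.
    have dv : d != v by apply: contraNneq nd => ->; apply: ltW.
    rewrite lt_neqAle dv /=; apply/negPn/negP => ndv; apply: no.
    exists n, v, m, d, w; rewrite md dw nv; split=> //.
    rewrite lt_neqAle vw andbT /=; apply: contraNneq ndv => ->; exact: ltW.
  rewrite mZ insW lfW; apply: IH vc; last exact: (released_push rV ins).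
  + exact: state_push ins lf.
  + exact: state_push insW lfW.
  + exact: pointwise_le_fill.
- case: V W okV okW VW rV => [|v V] [|w W] // okV okW /andP[_ VW] rV; apply: IH.
  + exact: (state_pop remove_promotion okV).
  + exact: (state_pop remove_head okW).
  + exact: pointwise_le_trans (promote_le v V) VW.
  + by apply: (released_pop (E := remove_promotion)) rV; case: okV.
Qed.

(** * A code that only promotion accepts *)

(** Sorting by the size of principal down-sets gives a linear extension. *)
Definition linearize s :=
  sort (relpre (fun x => #|[set z | z <= x]|) leq) s.

Lemma perm_linearize s : perm_eq (linearize s) s.
Proof. exact: permEl (perm_sort _ _). Qed.

Lemma linext_linearize s : linext (linearize s).
Proof.
have lel : transitive (relpre (fun x => #|[set z | z <= x]|) leq).
  by move=> y x z; apply: leq_trans.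
apply: (@sub_pairwise _ (relpre (fun x => #|[set z | z <= x]|) leq)).
  move=> x y /=; rewrite leqNgt; apply: contra => yx; apply: proper_card.
  apply/properP; split.
    by apply/subsetP => z; rewrite !inE => /le_trans; apply; apply: ltW.
  by exists x; rewrite !inE ?lexx // lt_geF.
by rewrite -sorted_pairwise // sort_sorted // => x y; apply: leq_total.
Qed.

Lemma mem_linearize s x : (x \in linearize s) = (x \in s).
Proof. exact/perm_mem/perm_linearize. Qed.

Lemma pmap_Some s : pmap id (map Some s) = s.
Proof. exact: map_pK. Qed.

Lemma count_Some s : count_mem None (map (@Some P) s) = 0.
Proof. by elim: s. Qed.

Lemma fill_Some s p W : fill (map Some s ++ p) W = s ++ fill p W.
Proof. by elim: s => //= x s ->. Qed.

(** Every state can be run to the end, so a code needs to be exhibited only up to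
    the insertion that head removal rejects. *)
Lemma completable E Z V : state_ok Z V -> exists c, valid E Z V c.
Proof.
move: {2}(#|Z| + size V)%N (leqnn (#|Z| + size V)) => n.
elim: n Z V => [|n IH] Z [|h V].
- by rewrite addn0 leqn0 cards_eq0 => /eqP-> _; exists [::]; rewrite /= eqxx.
- by rewrite addnS.
- have [->|[m mZ]] := set_0Vmem Z; first by exists [::]; rewrite /= eqxx.
  rewrite addn0 => leZ okZ; pose L := linearize (enum (above Z m)).
  have fL : fill (map Some L) [::] = L by have := fill_Some L [::] [::]; rewrite !cats0.
  have ins : insertable Z m [::] (map Some L).
    by rewrite /insertable pmap_Some count_Some eqxx perm_linearize.
  have lf : linext (fill (map Some L) [::]) by rewrite fL linext_linearize.
  have [|c vc] := IH _ _ _ (state_push okZ mZ ins lf).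
    rewrite fL (perm_size (perm_linearize _)) -ltnS.
    by move: leZ; rewrite cardE (perm_size (perm_enum_step mZ)) /= size_cat -!cardE addnC.
  by exists (Some (m, map Some L) :: c); rewrite /= mZ ins lf.
- rewrite addnS ltnS => leV okV; have [|c vc] := IH _ _ _ (state_pop E okV).
    by case: okV => /(removeP E)[_ _ /perm_size/= [->] _].
  by exists (None :: c).
Qed.

Definition remove_one E W := if W is h :: V then rest E h V else [::].

Lemma valid_removals E Z W k c : linext W -> (k <= size W)%N ->
  valid E Z W (nseq k None ++ c) = valid E Z (iter k (remove_one E) W) c.
Proof.
elim: k W => [|k IH] [|h V] // lW kV; rewrite iterSr /=.
have [_ lr /perm_size/= [sV] _] := removeP E lW.
by rewrite IH // sV.
Qed.

Definition greedy_chain_top (a : P) s := foldl (fun l y => if l < y then y else l) a s.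

(** Only the last entry of the word matters below, and inverse promotion acts on
    it in a simple way. *)
Lemma last_demote x y R : R != [::] ->
  last x ((demote y R).1 :: (demote y R).2) =
  if last x R < y then y else last x R.
Proof.
elim: R => [//|u R IH] _ /=.
case: R IH => [|u' R] IH; first by rewrite /=; case: ifP.
move: (IH isT) (perm_size (perm_demote y (u' :: R))).
case: (demote y (u' :: R)) => h [|v V] //= <- _.
by case: ifP.
Qed.

(** Undoing the promotions that take out s in reverse order gives a word V that
    promotion reduces to a, while head removal reduces it to its last entry. *)
Lemma promotion_leaves_head a s : linext (a :: s) -> exists V,
  [/\ perm_eq V (a :: s), linext V,
      iter (size s) (remove_one remove_promotion) V = [:: a]
    & last a V = greedy_chain_top a s].
Proof.
elim/last_ind: s => [|s y IH]; first by exists [:: a].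
rewrite /linext -rcons_cons -cats1 pairwise_cat allrel1r => /and3P[sy ls _].
have [V [pV lV iV tV]] := IH ls.
have yV : all (fun z => ~~ (y < z)) V.
  by rewrite (perm_all _ pV); exact: sy.
have V0 : V != [::] by apply: contraTneq pV => ->; apply/negP => /perm_size.
have := last_demote a y V0.
have := undoP lV (yV : all (fun z => ~~ forbids remove_promotion y z) V).
rewrite /=; case: (demote y V) => h U [lU pU _ rU] /= lastU.
exists (h :: U); split=> //.
- by rewrite (perm_trans pU) // -cat_cons cats1 perm_sym perm_rcons perm_cons perm_sym.
- by rewrite size_rcons iterSr /= rU.
- by rewrite /greedy_chain_top foldl_rcons /= lastU tV.
Qed.

Lemma greedy_chain_top_ge (a c : P) s1 s2 : all (fun x => x < c) (a :: s1) ->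
  c <= greedy_chain_top a (s1 ++ c :: s2).
Proof.
have ge l s : l <= greedy_chain_top l s.
  elim: s l => [//|x s IH] l /=; apply: le_trans (IH _).
  by case: ifP => [/ltW|].
rewrite /greedy_chain_top foldl_cat /= -/(greedy_chain_top _ _) => ac.
suff -> : greedy_chain_top a s1 < c by apply: ge.
elim: s1 a ac => [|x s1 IH] a /=; first by rewrite andbT.
by case/and3P=> ac xc s1c; apply: IH; case: ifP => _; apply/andP.
Qed.

Lemma iter_remove_head k V : iter k (remove_one remove_head) V = drop k V.
Proof. by elim: k V => [|k IH] [|h V] //; rewrite iterSr IH. Qed.

Lemma obstruction_strict : obstruction -> exists c,
  valid remove_promotion setT [::] c && ~~ valid remove_head setT [::] c.
Proof.
case=> m [a [m' [b [c [/andP[ma ac] /andP[m'b bc] mb ba]]]]].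
(* Only an element that is minimal above m can be what promotion leaves. *)
have [a0 [ma0 a0a a0min]] : exists a0, [/\ m < a0, a0 <= a
    & forall x, m < x -> ~~ (x < a0)].
  pose L := linearize (enum [set x | m < x <= a]).
  have memL x : (x \in L) = (m < x <= a) by rewrite mem_linearize mem_enum inE.
  have := linext_linearize (enum [set x | m < x <= a]); rewrite -/L.
  case EL: L => [|a0 L'] lL; first by have := memL a; rewrite EL ma lexx.
  have /esym/andP[ma0 a0a] : true = (m < a0 <= a) by rewrite -memL EL inE eqxx.
  exists a0; split=> // x mx; apply/negP => xa0.
  have : x \in L by rewrite memL mx (ltW (lt_le_trans xa0 a0a)).
  rewrite EL inE => /orP[/eqP e|xL']; first by rewrite e ltxx in xa0.
  by case/andP: lL => /allP/(_ x xL'); rewrite xa0.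
have a0c : a0 < c by apply: le_lt_trans ac.
have ba0 : ~~ (b <= a0) by apply: contra ba => /le_trans; apply.
have mc : m < c by apply: lt_trans ac.
(* Below c first, then c, then the rest: the greedy chain that starts at a0 must
   then pass through c, so the last entry of V is above b. *)
pose u1 := linearize (enum [set x | [&& m < x, x < c & x != a0]]).
pose u2 := linearize (enum [set x | (m < x) && ~~ (x <= c)]).
pose u := u1 ++ c :: u2.
have mem1 x : (x \in u1) = [&& m < x, x < c & x != a0].
  by rewrite mem_linearize mem_enum inE.
have mem2 x : (x \in u2) = (m < x) && ~~ (x <= c) by rewrite mem_linearize mem_enum inE.
have lu : linext (a0 :: u).
  rewrite /linext /= pairwise_cat pairwise_cons -!/(linext _) !linext_linearize !andbT.
  apply/and3P; split.
  - apply/allP => x; rewrite mem_cat inE mem1 mem2.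
    by case/or3P=> [/andP[/a0min]|/eqP->|/andP[/a0min]] //; apply: a0min.
  - apply/allrelP => x y; rewrite mem1 inE mem2 => /and3P[_ xc _].
    case/orP=> [/eqP->|/andP[_ yc]]; first by rewrite lt_gtF.
    by apply: contra yc => yx; apply/ltW/(lt_trans yx).
  - by apply/allP => x; rewrite mem2 => /andP[_]; apply: contra => /ltW.
have pu : perm_eq (a0 :: u) (enum (above setT m)).
  apply: uniq_perm; rewrite ?enum_uniq //.
    rewrite /= /u mem_cat inE mem1 mem2 (ltW a0c) eqxx !andbF orbF /= (lt_eqF a0c) /=.
    rewrite cat_uniq /= !(perm_uniq (perm_linearize _)) !enum_uniq mem1 mem2.
    rewrite lexx ltxx !andbF /=.
    rewrite andbT; apply/hasPn => x; rewrite mem1 mem2 => /andP[_].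
    by apply: contra => /and3P[_ /ltW].
  move=> x; rewrite inE mem_cat inE mem1 mem2 mem_enum !inE.
  case: (eqVneq x a0) => [->|_]; first by rewrite ma0.
  case: (eqVneq x c) => [->|xc]; first by rewrite mc orbT.
  by rewrite [x < c]lt_neqAle xc /=; case: (x <= c); case: (m < x).
have [V [pV lV iV tV]] := promotion_leaves_head lu.
have top : c <= last a0 V.
  rewrite tV; apply: greedy_chain_top_ge; rewrite /= a0c /=.
  by apply/allP => x; rewrite mem1 => /and3P[].
have sV : size V = (size u).+1 by rewrite (perm_size pV).
have fV : fill (map Some V) [::] = V by have := fill_Some V [::] [::]; rewrite !cats0.
have insV : insertable setT m [::] (map Some V).
  by rewrite /insertable pmap_Some count_Some eqxx andbT (perm_trans pV).
pose Z := step setT m.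
have memZ x : (x \in Z) = ~~ (m <= x) by rewrite !inE.
have m'Z : m' \in Z by rewrite memZ; apply: contra mb => /le_trans; apply; apply: ltW.
(* The elements made available by m' are inserted as late as a0 permits; b then
   comes behind the single old element. *)
pose D1 := linearize (enum [set d in above Z m' | d < a0]).
pose D2 := linearize (enum [set d in above Z m' | ~~ (d < a0)]).
have memD1 x : (x \in D1) = (x \in above Z m') && (x < a0).
  by rewrite mem_linearize mem_enum inE.
have memD2 x : (x \in D2) = (x \in above Z m') && ~~ (x < a0).
  by rewrite mem_linearize mem_enum inE.
pose p := map Some D1 ++ None :: map Some D2.
have fp x : fill p [:: x] = D1 ++ x :: D2.
  by rewrite fill_Some /= -[map Some D2]cats0 fill_Some /= cats0.
have insp x : insertable Z m' [:: x] p.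
  rewrite /insertable count_cat /= !count_Some eqxx andbT /p.
  rewrite (_ : pmap id _ = D1 ++ D2); last first.
    by elim: (D1) => [|? ? /= ->] //=; rewrite pmap_Some.
  apply: uniq_perm; rewrite ?enum_uniq //.
    rewrite cat_uniq !(perm_uniq (perm_linearize _)) !enum_uniq andbT.
    by apply/hasPn => y; rewrite memD1 memD2 => /andP[_]; apply: contra => /andP[].
  by move=> y; rewrite mem_cat memD1 memD2 mem_enum -andb_orr orbN andbT.
have lfp : linext (fill p [:: a0]).
  rewrite fp /linext pairwise_cat pairwise_cons -!/(linext _) !linext_linearize !andbT.
  apply/andP; split.
    apply/allrelP => x y; rewrite memD1 in_cons memD2 => /andP[_ xa0].
    case/orP=> [/eqP->|/andP[_]]; first by rewrite lt_gtF.
    by apply: contra => yx; apply: lt_trans xa0.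
  by rewrite /=; apply/allP => y /=; rewrite memD2 => /andP[].
have ok0 : state_ok Z [:: a0].
  split=> // x z; rewrite inE => /eqP->; rewrite memZ; apply: contra.
  by apply: le_trans; apply: ltW.
have [d vd] := completable remove_promotion (state_push ok0 m'Z (insp a0) lfp).
exists (Some (m, map Some V) :: nseq (size u) None ++ Some (m', p) :: d).
rewrite /= fV !insV !lV !in_setT /= -/Z !valid_removals ?sV // iV.
have -> : iter (size u) (remove_one remove_head) V = [:: last a0 V].
  rewrite iter_remove_head; case/lastP: V sV {pV lV iV tV top fV insV} => // V x.
  by rewrite size_rcons last_rcons => -[<-]; rewrite -cats1 drop_size_cat.
rewrite /= m'Z insp lfp vd /= insp /= negb_and fp.
apply/orP; left; rewrite /linext pairwise_cat pairwise_cons; apply/negP.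
case/and3P=> _ _ /andP[/allP/(_ b) + _].
rewrite memD2 !inE (lt_le_trans bc top) mb m'b /= => /(_ _)/negP; apply=> //.
by apply: contra ba0 => /ltW.
Qed.

(** * From permutations to codes *)

Definition unblocked s := [set z | all (fun y => ~~ (y <= z)) s].

Lemma unblocked_rcons s x : unblocked (rcons s x) =
  if x \in unblocked s then step (unblocked s) x else unblocked s.
Proof.
apply/setP => z; rewrite !inE all_rcons.
case: ifPn => [_|/allPn[y ys /negPn yx]]; rewrite !inE 1?andbC //.
case sz: (all _ s); rewrite ?andbF //= ?andbT.
by have := allP sz y ys; apply: contra => /(le_trans yx).
Qed.

(** An entry x outside of [unblocked q] has some y of q below it; the
    comparability of x and z then gives one y below both, as in the patterns. *)
Lemma avoids_unblocked E q s : uniq (q ++ s) ->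
  avoids E (unblocked q) s <->
  forall s1 x s2, s = s1 ++ x :: s2 -> forall y z, y \in q ++ s1 -> z \in s2 ->
    y < x -> y < z -> ~~ forbids E x z.
Proof.
elim: s q => [|x s IH] q uqs /=; first by split=> // _ [|? ?].
have := IH (rcons q x); rewrite cat_rcons unblocked_rcons => /(_ uqs) {}IH.
have nqx : x \notin q by move: uqs; rewrite uniq_catC /= mem_cat => /andP[/norP[]].
have hd : (x \in unblocked q) || all (fun z => (z \in unblocked q) || ~~ forbids E x z) s
  <-> forall y z, y \in q -> z \in s -> y < x -> y < z -> ~~ forbids E x z.
  split=> [/orP[xu|/allP av] y z yq zs yx yz|av].
  - by move: xu; rewrite inE => /allP/(_ y yq); rewrite ltW.
  - have /orP[zu|//] := av z zs.
    by move: zu; rewrite inE => /allP/(_ y yq); rewrite ltW.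
  rewrite inE -implyNb; apply/implyP => /allPn[y1 y1q /negPn y1x].
  apply/allP => z zs; rewrite inE -implyNb.
  apply/implyP => /allPn[y2 y2q /negPn y2z]; apply/negP => xz.
  have {}y1x : y1 < x by rewrite lt_neqAle y1x andbT; apply: contraNneq nqx => <-.
  have {}y2z : y2 < z.
    rewrite lt_neqAle y2z andbT; apply: contraTneq uqs => e.
    rewrite cat_uniq; apply/negP => /and3P[_ /hasPn/(_ z) + _].
    by rewrite inE zs orbT -e y2q => /(_ isT).
  have /orP[lxz|lzx] := forbids_comparable xz.
    by move/negP: (av y1 z y1q zs y1x (lt_trans y1x lxz)).
  by move/negP: (av y2 z y2q zs (lt_trans y2z lzx) y2z).
have -> : (if x \in unblocked q then avoids E (step (unblocked q) x) s
    else all (fun z => (z \in unblocked q) || ~~ forbids E x z) s &&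
         avoids E (unblocked q) s) =
  ((x \in unblocked q) || all (fun z => (z \in unblocked q) || ~~ forbids E x z) s) &&
  avoids E (if x \in unblocked q then step (unblocked q) x else unblocked q) s.
  by case: ifP.
split=> [/andP[/hd av /IH avs] [|x1 s1] x' s2 [e1 e2]|av].
- by rewrite cats0 -e1 -e2; apply: av.
- by move=> y z yq; apply: (avs s1 x' s2) => //; rewrite e1 cat_rcons.
apply/andP; split.
  by apply/hd => y z yq; apply: (av [::] x s) => //; rewrite cats0.
apply/IH => s1 x' s2 es y z; rewrite cat_rcons.
by apply: (av (x :: s1) x' s2); rewrite es.
Qed.

Lemma nth_codom_ord x0 (t : {ffun 'I_#|P| -> P}) (i : 'I_#|P|) :
  nth x0 (codom t) i = t i.
Proof. by rewrite /codom /image_mem (nth_map i) ?nth_ord_enum // -cardE card_ord. Qed.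

Lemma avoids_codom E (t : {ffun 'I_#|P| -> P}) : injective t ->
  avoids E setT (codom t) <->
  forall i1 i2 i3 : 'I_#|P|, (i1 < i2)%N -> (i2 < i3)%N ->
    t i1 < t i2 -> t i1 < t i3 -> ~~ forbids E (t i2) (t i3).
Proof.
move=> injt.
have szt : size (codom t) = #|P| by rewrite size_codom card_ord.
have nt x0 := nth_codom_ord x0 t.
have -> : setT = unblocked [::] by apply/setP => z; rewrite !inE.
have [|avP avPV] := @avoids_unblocked E [::] (codom t).
  by rewrite /= map_inj_uniq ?enum_uniq.
split=> [/avP/= av i1 i2 i3 i12 i23|av]; last first.
  apply: avPV => s1 x s2 et y z /= ys1 zs2.
  have szs : (size s1 + (size s2).+1)%N = #|P| by rewrite -szt et size_cat.
  have lt1 : (index y s1 < #|P|)%N.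
    by rewrite -szs (leq_trans (_ : _ < size s1)%N) ?index_mem ?leq_addr.
  have lt2 : (size s1 < #|P|)%N by rewrite -szs -addSnnS leq_addr.
  have lt3 : (size s1 + (index z s2).+1 < #|P|)%N.
    by rewrite -szs ltn_add2l ltnS index_mem.
  have e1 : t (Ordinal lt1) = y.
    by rewrite -(nt y) et nth_cat /= index_mem ys1 nth_index.
  have e2 : t (Ordinal lt2) = x.
    by rewrite -(nt y) et nth_cat /= ltnn subnn.
  have e3 : t (Ordinal lt3) = z.
    by rewrite -(nt z) et nth_cat /= ltnNge leq_addr /= addKn /= nth_index.
  have := av (Ordinal lt1) (Ordinal lt2) (Ordinal lt3); rewrite e1 e2 e3; apply.
    by rewrite /= index_mem.
  by rewrite /= addnS ltnS leq_addr.
have lt2 : (i2 < size (codom t))%N by rewrite szt.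
apply: (av (take i2 (codom t)) _ (drop i2.+1 (codom t))).
- by rewrite -{1}(cat_take_drop i2 (codom t)) (drop_nth (t i2)) ?nt.
- rewrite -(nt (t i1)) -(nth_take _ i12); apply: mem_nth.
  by rewrite size_take lt2.
rewrite -(nt (t i3)) -(subnKC i23) -nth_drop; apply: mem_nth.
by rewrite size_drop ltn_sub2r ?szt // (leq_ltn_trans i23).
Qed.

(** The number of avoiders is thus a number of codes, and codes for the two
    patterns can be compared by inclusion. *)
Lemma codes_of_avoiders E (A : {set {ffun 'I_#|P| -> P}}) :
    (forall t, (t \in A) = is_permutation_on t && avoids E setT (codom t)) ->
  exists L : seq (seq instruction), [/\ uniq L, size L = #|A|
    & forall c, (c \in L) = valid E setT [::] c].
Proof.
move=> memA; pose f (t : {ffun 'I_#|P| -> P}) := encode E setT (codom t).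
have enc t : t \in A -> valid E setT [::] (f t) /\ decode E setT [::] (f t) = codom t.
  rewrite memA => /andP[/andP[/injectiveP injt /forallP surj] av].
  have ok : suffix_ok setT (codom t).
    split=> [|x _|y z _]; rewrite ?inE //; first by rewrite map_inj_uniq ?enum_uniq.
    by have /existsP[i /eqP <-] := surj x; apply: codom_f.
  have [pw _ vl dc] := encodeP ok av.
  suff w0 : word E setT (codom t) = [::] by rewrite w0 in vl dc.
  move: pw; rewrite (eq_filter (a2 := pred0)) ?filter_pred0 => [/perm_nilP//|x].
  by rewrite inE.
exists [seq f t | t <- enum A]; split.
- rewrite map_inj_in_uniq ?enum_uniq // => t t'; rewrite !mem_enum => tA t'A ff.
  have [_ dt] := enc t tA; have [_ dt'] := enc t' t'A.
  have ett' : codom t = codom t' by rewrite -dt -dt' ff.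
  by apply/ffunP => i; rewrite -(nth_codom_ord (t i)) ett' nth_codom_ord.
- by rewrite size_map -cardE.
move=> c; apply/mapP/idP => [[t]|vc]; first by rewrite mem_enum => /enc[vt _] ->.
have ok : state_ok setT [::] by [].
have [ps av _ en] := decodeP ok vc; set s := decode _ _ _ _ in ps av en *.
have sz : size s = #|P| by rewrite (perm_size ps) /= -cardE cardsT.
pose t := [ffun i : 'I_#|P| => nth (enum_val i) s i].
have ts : codom t = s.
  case es: s => [|x0 s']; first by apply: size0nil; rewrite size_codom card_ord -sz es.
  rewrite -es; apply: (@eq_from_nth _ x0); rewrite size_codom card_ord ?sz // => i lti.
  rewrite -[i]/(val (Ordinal lti)) nth_codom_ord ffunE.
  by apply: set_nth_default; rewrite sz.
have us : uniq s by rewrite (perm_uniq ps) enum_uniq.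
exists t; last by rewrite /f ts.
rewrite mem_enum memA ts av andbT; apply/andP; split.
  apply/injectiveP/injectiveP; rewrite /injectiveb /dinjectiveb.
  by move: us; rewrite -ts.
apply/forallP => x; have : x \in codom t by rewrite ts (perm_mem ps) mem_enum inE.
by case/codomP => i ->; apply/existsP; exists i.
Qed.

(** * Obstructions and the three posets *)

Lemma obstruction_dec : decidable obstruction.
Proof.
apply: (@decP _ [exists m : P, exists a : P, exists m' : P, exists b : P, exists c : P,
  [&& m < a < c, m' < b < c, ~~ (m <= b) & ~~ (b <= a)]]).
apply: (iffP existsP) => [[m /existsP[a /existsP[m' /existsP[b /existsP[c /and4P]]]]]|].
  by exists m, a, m', b, c.
case=> m [a [m' [b [c /and4P mabc]]]].
exists m; apply/existsP; exists a; apply/existsP; exists m'.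
by apply/existsP; exists b; apply/existsP; exists c.
Qed.

Lemma obstruction_of_induced (Q : rel abcde) :
    Q qd qa -> Q qa qc -> Q qe qb -> Q qb qc -> ~~ Q qd qb -> ~~ Q qb qa ->
  contains_induced P Q -> obstruction.
Proof.
move=> da ac eb bc db ba [f [injf fQ]].
exists (f qd), (f qa), (f qe), (f qb), (f qc).
by split; rewrite ?le_eqVlt ?fQ ?da ?ac ?eb ?bc //= negb_or ?db ?ba andbT;
   apply/eqP => /injf.
Qed.

(** Injectivity comes for free: in each of the posets distinct elements have
    distinct relations to the others. *)
Lemma induced_of_lt (Q : rel abcde) (f : abcde -> P) :
    (forall x y : abcde, x <> y -> exists z : abcde, Q x z != Q y z \/ Q z x != Q z y) ->
    (forall x y : abcde, (f x < f y) = Q x y) ->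
  contains_induced P Q.
Proof.
move=> sep fQ; exists f; split=> // x y fxy.
have eqxy : ({x = y} + {x <> y})%type by decide equality.
case: eqxy => // /sep[z]; rewrite -!fQ fxy !eqxx.
by case.
Qed.

Lemma obstructionE : obstruction <->
  [\/ contains_induced P Q1, contains_induced P Q2 | contains_induced P Q3].
Proof.
split; last by case; apply: obstruction_of_induced.
case=> m [a [m' [b [c [/andP[ma ac] /andP[m'b bc] mb ba]]]]].
have mc := lt_trans ma ac; have m'c := lt_trans m'b bc.
have nlt (x y : P) : ~~ (x <= y) -> (x < y) = false.
  by move=> nxy; apply/negbTE; apply: contra nxy => /ltW.
have ab : ~~ (a <= b) by apply: contra mb; apply/le_trans/ltW.
have bm : ~~ (b <= m) by apply: contra ba => /le_trans; apply; apply: ltW.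
have mm' : ~~ (m <= m') by apply: contra mb => /le_trans; apply; apply: ltW.
have am' : ~~ (a <= m') by apply: contra ab => /le_trans; apply; apply: ltW.
pose f (i : abcde) := match i with qa => a | qb => b | qc => c | qd => m | qe => m' end.
have m'm_m'a : m' < m -> m' < a by move/lt_trans; apply.
case m'm : (m' < m); [apply: Or33 | case m'a : (m' < a); [apply: Or32 | apply: Or31]].
all: apply: (@induced_of_lt _ f).
all: try by case; case; rewrite /f /= ?ltxx ?ma ?ac ?m'b ?bc ?mc ?m'c ?m'm ?m'a
  ?(m'm_m'a m'm) ?(nlt _ _ ab) ?(nlt _ _ ba) ?(nlt _ _ bm) ?(nlt _ _ mm')
  ?(nlt _ _ am') ?(nlt _ _ mb) //; apply/lt_gtF.
all: move=> x y nxy.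
all: by case: x y nxy => [] [] // _; first
  [exists qa; by auto | exists qb; by auto | exists qc; by auto
  | exists qd; by auto | exists qe; by auto].
Qed.

End Words.

Theorem theorem3 (disp : Order.disp_t) (P : finPOrderType disp) :
  (Av132 P <= Av123 P)%N /\
  ((Av132 P < Av123 P)%N <->
   [\/ contains_induced P Q1, contains_induced P Q2 | contains_induced P Q3]).
Proof.
have [t|L [uL sL memL]] := @codes_of_avoiders _ _ (@remove_promotion _ P)
    [set s : {ffun 'I_#|P| -> P} | is_permutation_on s & ~~ contains123 s].
  rewrite inE; apply: andb_id2l => /andP[/injectiveP injt _].
  apply/idP/idP => [/negP n123|/(avoids_codom _ injt) av].
    apply/(avoids_codom _ injt) => i1 i2 i3 i12 i23 t12 t13.
    apply/negP => /= t23; apply: n123.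
    apply/existsP; exists i1; apply/existsP; exists i2.
    by apply/existsP; exists i3; apply/and4P.
  apply/negP => /existsP[i1 /existsP[i2 /existsP[i3 /and4P[i12 i23 t12 t23]]]].
  by have := av i1 i2 i3 i12 i23 t12 (lt_trans t12 t23); rewrite /= t23.
have [t|L' [uL' sL' memL']] := @codes_of_avoiders _ _ (@remove_head _ P)
    [set s : {ffun 'I_#|P| -> P} | is_permutation_on s & ~~ contains132 s].
  rewrite inE; apply: andb_id2l => /andP[/injectiveP injt _].
  apply/idP/idP => [/negP n132|/(avoids_codom _ injt) av].
    apply/(avoids_codom _ injt) => i1 i2 i3 i12 i23 t12 t13.
    apply/negP => /= t32; apply: n132.
    apply/existsP; exists i1; apply/existsP; exists i2.
    by apply/existsP; exists i3; apply/and4P.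
  apply/negP => /existsP[i1 /existsP[i2 /existsP[i3 /and4P[i12 i23 t13 t32]]]].
  by have := av i1 i2 i3 i12 i23 (lt_trans t13 t32) t13; rewrite /= t32.
rewrite /Av132 /Av123 -sL -sL'.
have ok0 : state_ok [set: P] [::] by [].
have sub : {subset L' <= L}.
  by move=> c; rewrite memL memL'; apply: valid_head_promotion.
have leLL' := uniq_leq_size uL' sub; split=> //; split.
  move=> ltLL'; apply/obstructionE; have [//|no] := @obstruction_dec _ P.
  have {}sub : {subset L <= L'}.
    by move=> c; rewrite memL memL'; apply: valid_promotion_head.
  by rewrite ltnNge (uniq_leq_size uL sub) in ltLL'.
case/obstructionE/obstruction_strict=> c /andP[]; rewrite -memL -memL' => cL ncL'.
rewrite ltn_neqAle leLL' andbT; apply: contra ncL' => /eqP eqsz.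
by have [_ ->] := uniq_min_size uL' sub (eq_leq (esym eqsz)).
Qed.
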